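(* Let $u,v\in\mathbb{R}^2$ be linearly independent unit vectors with angle $2\beta\in(0,\pi)$ between them, let $c_u\neq0$, $c_v>0$ be real constants, and let $\beta_1$ and $\widetilde\alpha$ be the angle and unit vector associated with them (defined in the context). Consider a bounded, open, convex set $\Omega$ in $\mathbb{R}^2$ and let $g=T_wf$ be the weighted V-line transform of $f\in C_c(\mathbb{R}^2)$ with weights $c_u,c_v$. For each point $p=(x,y)\in\Omega$ let $$m_p=\inf\{s\geq0: p+s\widetilde\alpha\in\partial\Omega\},\qquad m_n=m_p-\tfrac1n,$$ $$(x_n,y_n)=(x,y)+m_n\widetilde\alpha,\qquad (x_0,y_0)=(x,y)+m_p\widetilde\alpha .$$ Then $(x_n,y_n)\to(x_0,y_0)$ and $$f(x,y)=f(x_0,y_0)+\lim_{n\to\infty}\frac{\sin\beta_1}{c_v\sin(2\beta)}\,\left.\frac{\partial}{\partial u}\frac{\partial}{\partial v}\int_0^{m_n}g(q+s\widetilde\alpha)\,ds\,\right|_{q=p},$$ where the directional derivatives are taken with respect to the base point $q$, the upper limit $m_n$ (determined by the given point $p$) being held fixed.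
   Context: For $(x,y)\in\mathbb{R}^2$ and a unit vector $w$, $R_w(x,y)=\{(x,y)+tw:t\ge0\}$. The weighted V-line transform is $(T_wf)(x,y)=c_v\int_{R_v(x,y)}f\,dl+c_u\int_{R_u(x,y)}f\,dl$, where $dl$ is the one-dimensional Lebesgue measure. The angles $\beta_1\in(0,\pi)$ and $\beta_2$ with $|\beta_2|\in(0,\pi)$ are uniquely determined by $\beta_1+\beta_2=2\beta$ and $\frac{\sin\beta_1}{\sin\beta_2}=\frac{c_v}{c_u}$, and $\widetilde\alpha=\frac{c_uv+c_vu}{\|c_uv+c_vu\|}$. $\frac{\partial}{\partial u},\frac{\partial}{\partial v}$ are directional derivatives. The expression in the limit is considered for $n$ large enough that $m_n>0$. *)

(* Defs.v *)
From HB Require Import structures.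
From mathcomp Require Import all_boot all_order all_algebra.
From mathcomp Require Import all_classical all_reals all_analysis.

Set Implicit Arguments.
Unset Strict Implicit.
Unset Printing Implicit Defensive.

Import Order.TTheory GRing.Theory Num.Theory.
Import numFieldNormedType.Exports.

Local Open Scope classical_set_scope.
Local Open Scope ring_scope.

(* The library norm [`|w|] on ['rV[R]_2] is the sup norm. It gives the usual
   topology and bounded sets of the plane, but unit vectors, angles and
   normalization need the Euclidean norm. *)
Definition dot (R : realType) (u v : 'rV[R]_2) : R := (u *m v^T) 0 0.

Definition enorm (R : realType) (u : 'rV[R]_2) : R := Num.sqrt (dot u u).

Definition angle (R : realType) (u v : 'rV[R]_2) : R :=
  acos (dot u v / (enorm u * enorm v)).

Definition boundary (T : topologicalType) (A : set T) : set T :=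
  closure A `\` A°.

(* Continuous functions with compact support. *)
Definition Cc (R : realType) (f : 'rV[R]_2 -> R) : Prop :=
  continuous f /\ compact (closure [set x | f x != 0]).

(* Integral of f over the ray {p + t w : t >= 0} with respect to arc length;
   the parametrization has unit speed when [enorm w = 1]. *)
Definition ray_integral (R : realType) (w : 'rV[R]_2) (f : 'rV[R]_2 -> R)
    (p : 'rV[R]_2) : R :=
  \int[@lebesgue_measure R]_(t in `[0, +oo[) f (p + t *: w).

Definition vline_transform (R : realType) (u v : 'rV[R]_2) (cu cv : R)
    (f : 'rV[R]_2 -> R) (p : 'rV[R]_2) : R :=
  cv * ray_integral v f p + cu * ray_integral u f p.

Definition weighted_axis (R : realType) (u v : 'rV[R]_2) (cu cv : R) :
    'rV[R]_2 :=
  (enorm (cu *: v + cv *: u))^-1 *: (cu *: v + cv *: u).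

Definition exit_time (R : realType) (Omega : set 'rV[R]_2)
    (a p : 'rV[R]_2) : R :=
  inf [set s : R | 0 <= s /\ boundary Omega (p + s *: a)].

Definition segment_integral (R : realType) (a : 'rV[R]_2) (m : R)
    (g : 'rV[R]_2 -> R) (q : 'rV[R]_2) : R :=
  \int[@lebesgue_measure R]_(s in `[0, m]) g (q + s *: a).

(* Main.v *)
Require Import Defs.
From HB Require Import structures.
From mathcomp Require Import all_boot all_order all_algebra.
From mathcomp Require Import all_classical all_reals all_analysis.
From mathcomp Require Import ring lra.

Set Implicit Arguments.
Unset Strict Implicit.
Unset Printing Implicit Defensive.

Import Order.TTheory GRing.Theory Num.Theory.
Import numFieldNormedType.Exports.

Local Open Scope classical_set_scope.
Local Open Scope ring_scope.

(** Write [X_w f] for [ray_integral w f] and [S_m k] for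
    [segment_integral a m k].  Two identities hold: [D_w (X_w f) = - f] for
    rays, [f] being continuous with compact support, and
    [D_a (S_m k) q = k (q + m a) - k q] for the segment in the direction [a] of
    the weighted axis, [k] being continuous.

    Formally, with [N = | cu v + cv u |], the operator [D_u D_v] turns
    [g = cv X_v f + cu X_u f] into [- (cv D_u f + cu D_v f) = - N D_a f], whose
    integral over the segment telescopes to [N (f p - f (p + m a))].  As [f]
    is merely continuous, [D_a f] need not exist, so the derivatives are taken
    in another order.  Integrating first,
    [S_m g = cv S_m (X_v f) + cu S_m (X_u f)].  The first term has
    [v]-derivative [- cv S_m f] by differentiation under the integral.  For the
    second, [v = (N / cu) a - (cv / cu) u], and [S_m (X_u f)] has continuous
    derivatives in both directions [a] and [u], namely the difference of
    [X_u f] at the ends of the segment, and [- S_m f].  The two multiples of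
    [S_m f] cancel, leaving
    [D_v (S_m g) q = N (X_u f (q + m a) - X_u f q)]
    ([is_derive_segment_vline]).  This can be differentiated along [u] and
    gives [N (f p - f (p + m a))] ([is_derive_ray_gap]).

    The coefficient in front of the limit is [1 / N], by the law of sines in
    the triangle with sides [cu v], [cv u] and their sum ([law_of_sines]).  The
    exit time is positive, because the domain is open and, being bounded, has a
    boundary point on the ray ([exit_time_gt0]); hence the formula holds for
    all large [n], and continuity of [f] gives the limit. *)

(** * Directional derivatives *)

Section DifferenceQuotients.
Context {R : realType} {V : normedModType R}.
Implicit Types (k : V -> R) (p q w : V).

Lemma is_derive_cvg k q w (d : R) :
  h^-1 * (k (q + h *: w) - k q) @[h --> (0 : R)^'] --> d -> is_derive q w k d.
Proof.
move=> kd.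
have E : (fun h : R => h^-1 *: ((k \o shift q) (h *: w) - k q)) =
         (fun h : R => h^-1 * (k (q + h *: w) - k q)).
  by apply/funext => h; rewrite /= [q + _]addrC.
apply: DeriveDef; first by rewrite /derivable E; apply: cvgP kd.
by rewrite /derive E; apply: cvg_lim => //; exact: Rhausdorff.
Qed.

Lemma cvg_is_derive k q w (d : R) :
  is_derive q w k d -> h^-1 * (k (q + h *: w) - k q) @[h --> (0 : R)^'] --> d.
Proof.
have E : (fun h : R => h^-1 *: ((k \o shift q) (h *: w) - k q)) =
         (fun h : R => h^-1 * (k (q + h *: w) - k q)).
  by apply/funext => h; rewrite /= [q + _]addrC.
by case; rewrite /derivable /derive E => kd <-.
Qed.

End DifferenceQuotients.

Section DirectionalDerivatives.
Context {R : realType} {V : normedModType R}.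
Implicit Types (k : V -> R) (p q w : V).

(** Reduces questions about directional derivatives to functions of one real
    variable: both sides have the same difference quotients. *)
Lemma is_derive_line k q w (r d : R) :
  is_derive (q + r *: w) w k d <->
  is_derive r 1 (fun s : R => k (q + s *: w)) d.
Proof.
have E h : k (q + r *: w + h *: w) - k (q + r *: w) =
           k (q + (r + h *: 1) *: w) - k (q + r *: w).
  by rewrite -addrA -scalerDl /GRing.scale /= mulr1.
split=> /cvg_is_derive kd; apply: is_derive_cvg; move: kd; apply: cvg_trans;
  by apply: near_eq_cvg; near=> h; rewrite E.
Unshelve. all: by end_near. Qed.

Lemma cvg_along q w : q + r *: w @[r --> (0 : R)] --> q.
Proof.
rewrite -[X in _ --> X]addr0 -[X in _ --> _ + X](scale0r w).
by apply: cvgD; [exact: cvg_cst|apply: cvgZ; [exact: cvg_id|exact: cvg_cst]].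
Qed.

Lemma continuous_translate k w :
  continuous k -> continuous (fun q => k (q + w)).
Proof.
move=> ck q; apply: (cvg_comp (fun x : V => x + w) k); last exact: ck.
by apply: cvgD; [exact: cvg_id|exact: cvg_cst].
Qed.

(** The point [r] is only located by [`|r| <= `|c|], which covers both signs of
    [c] at once and suffices for limits as [c] tends to 0. *)
Lemma directional_mvt k k' w : (forall q, is_derive q w k (k' q)) ->
  forall q (c : R), exists2 r, `|r| <= `|c| &
    k (q + c *: w) - k q = c * k' (q + r *: w).
Proof.
move=> kk' q c; pose phi := fun s : R => k (q + s *: w).
have dphi (s : R) : is_derive s (1 : R) phi (k' (q + s *: w)).
  by apply/is_derive_line.
have cphi : continuous phi.
  move=> s; apply: differentiable_continuous; apply/derivable1_diffP.
  by case: (dphi s).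
have phi0 : phi 0 = k q by rewrite /phi scale0r addr0.
have [c0|/ltW c0] := leP 0 c.
  have [r] := MVT_segment c0 (fun s _ => dphi s) (continuous_subspaceT cphi).
  rewrite in_itv /= => /andP[r0 rc]; rewrite phi0 subr0 mulrC => E.
  by exists r => //; rewrite !ger0_norm.
have [r] := MVT_segment c0 (fun s _ => dphi s) (continuous_subspaceT cphi).
rewrite in_itv /= => /andP[cr r0]; rewrite phi0 sub0r => E.
exists r; first by rewrite !ler0_norm // lerN2.
by rewrite -opprB E mulrN opprK mulrC.
Qed.

(** Continuity of the derivative along [a] alone suffices: the increment along
    [lam *: a + b] is split into the step [h *: b] from [q], and then the step
    along [a], which the mean value theorem turns into a value of [ka] at a
    point tending to [q].  Iterating it from [b = 0] treats scalar multiples. *)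
Lemma is_derive_comb k (ka : V -> R) a b q (lam d : R) :
  (forall q, is_derive q a k (ka q)) -> {for q, continuous ka} ->
  is_derive q b k d -> is_derive q (lam *: a + b) k (lam * ka q + d).
Proof.
move=> kka cka /cvg_is_derive kb; apply: is_derive_cvg.
have mvt h := directional_mvt kka (q + h *: b) (h * lam).
have [r rP] := choice (fun h => let: ex_intro2 s s1 s2 := mvt h in
  ex_intro (fun s => _ /\ _) s (conj s1 s2)).
have h0 : h @[h --> (0 : R)^'] --> (0 : R) by apply: cvg_within.
have r0 : r h @[h --> (0 : R)^'] --> (0 : R).
  apply/norm_cvg0P.
  apply: (@squeeze_cvgr _ _ _ _ (cst 0) (fun h => `|h * lam|)).
  - by near=> h; rewrite normr_ge0 (rP h).1.
  - exact: cvg_cst.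
  - apply/norm_cvg0P; rewrite -[X in _ --> X](mul0r lam).
    by apply: cvgM; [exact: h0|exact: cvg_cst].
have qh : q + h *: b + r h *: a @[h --> (0 : R)^'] --> q.
  rewrite -[X in _ --> X]addr0 -[X in _ --> _ + X](scale0r a).
  apply: cvgD; last by apply: cvgZ; [exact: r0|exact: cvg_cst].
  rewrite -[X in _ --> X]addr0 -[X in _ --> _ + X](scale0r b).
  by apply: cvgD; [exact: cvg_cst|apply: cvgZ; [exact: h0|exact: cvg_cst]].
have lim : lam * ka (q + h *: b + r h *: a) + h^-1 * (k (q + h *: b) - k q)
    @[h --> (0 : R)^'] --> lam * ka q + d.
  apply: cvgD kb; apply: cvgM; first exact: cvg_cst.
  exact: (cvg_comp _ _ qh cka).
apply: cvg_trans lim; apply: near_eq_cvg; near=> h.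
have h_neq0 : h != 0 by near: h; exact: nbhs_dnbhs_neq.
have -> : q + h *: (lam *: a + b) = q + h *: b + (h * lam) *: a.
  by rewrite scalerDr scalerA addrCA addrC.
rewrite /= -[in RHS](subrK (k (q + h *: b)) (k (_ + (h * lam) *: a))).
by rewrite (rP h).2; field.
Unshelve. all: by end_near. Qed.

End DirectionalDerivatives.

(** * Integrals of continuous functions over intervals *)

Section SegmentIntegralsOnTheLine.
Context {R : realType}.
Notation mu := (@lebesgue_measure R).
Implicit Types (phi psi : R -> R).

Lemma continuous_integrable_itv phi (a b : R) :
  continuous phi -> mu.-integrable `[a, b] (EFin \o phi).
Proof.
move=> cphi; apply: continuous_compact_integrable; first exact: segment_compact.
exact: continuous_subspaceT.
Qed.

Lemma Rintegral_dist_le phi psi (m e : R) : 0 <= m ->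
  continuous phi -> continuous psi ->
  (forall s, 0 <= s <= m -> `|phi s - psi s| <= e) ->
  `|\int[mu]_(s in `[0, m]) phi s - \int[mu]_(s in `[0, m]) psi s| <= e * m.
Proof.
move=> m0 cphi cpsi le_e.
have cB : continuous (fun s => phi s - psi s).
  by move=> s; apply: cvgB; [exact: cphi|exact: cpsi].
rewrite -RintegralB //; try exact: continuous_integrable_itv.
apply: (le_trans (le_normr_Rintegral _ _)) => //.
  exact: continuous_integrable_itv.
have -> : e * m = \int[mu]_(s in `[0, m]) e.
  rewrite Rintegral_cst //=.
  by rewrite lebesgue_measure_itv /= lte_fin;
    case: ltgtP m0 => //= [|<-]; rewrite ?subr0 // oppr0 addr0.
apply: le_Rintegral => //.
- by apply: (@continuous_integrable_itv (fun s => `|phi s - psi s|)) => s;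
    apply: cvg_norm; exact: cB.
- by apply: continuous_integrable_itv => s; exact: cvg_cst.
Qed.

Lemma continuous_antiderivative phi (a b : R) : continuous phi ->
  exists Phi : R -> R, forall x, a < x < b -> is_derive x 1 Phi (phi x).
Proof.
move=> cphi; exists (fun x => \int[mu]_(t in `[a, x]) phi t) => x /andP[ax xb].
have [||||Phix dPhi] := @continuous_FTC1 R phi (BLeft a) x b => //.
- exact: continuous_integrable_itv.
- exact: cphi.
- by apply: DeriveDef => //; rewrite -dPhi derive1E.
Qed.

Lemma Rintegral_antiderivative phi Phi (a b : R) : a < b -> continuous phi ->
  (forall x, a <= x <= b -> is_derive x 1 Phi (phi x)) ->
  \int[mu]_(s in `[a, b]) phi s = Phi b - Phi a.
Proof.
move=> ab cphi dPhi.
have cPhi x : a <= x <= b -> {for x, continuous Phi}.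
  move=> /dPhi dx; apply: differentiable_continuous; apply/derivable1_diffP.
  by case: dx.
rewrite /Rintegral (@continuous_FTC2 _ phi Phi) //.
- exact: continuous_subspaceT.
- split.
  + move=> x; rewrite in_itv /= => /andP[ax xb].
    by case: (dPhi x); rewrite ?ltW.
  + by apply: cvg_at_right_filter; apply: cPhi; rewrite lexx ltW.
  + by apply: cvg_at_left_filter; apply: cPhi; rewrite lexx ltW.
- move=> x; rewrite in_itv /= => /andP[ax xb].
  by rewrite derive1E; case: (dPhi x); rewrite ?ltW.
Qed.

(** The difference quotient of a sliding integral needs no change of variables:
    if [Phi] is an antiderivative of [phi], then [Phi (s + h)] is one of
    [phi (s + h)], so the integral is [Phi (m + h) - Phi h]. *)
Lemma is_derive_window phi (m : R) : 0 < m -> continuous phi ->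
  is_derive (0 : R) 1 (fun h => \int[mu]_(s in `[0, m]) phi (s + h))
    (phi m - phi 0).
Proof.
move=> m0 cphi.
(* The margins leave room for shifts [h] of absolute value less than 1. *)
have [Phi dPhi] := continuous_antiderivative (-1) (m + 1) cphi.
have sh (x h d : R) : is_derive (x + h) 1 Phi d <->
    is_derive x 1 (fun s => Phi (s + h)) d.
  have E : (fun s : R => Phi (s + h)) = (fun s : R => Phi (h + s *: 1)).
    by apply/funext => s; rewrite /GRing.scale /= mulr1 addrC.
  by rewrite E addrC -is_derive_line /GRing.scale /= mulr1.
have d : is_derive (0 : R) 1 (fun h => Phi (h + m) - Phi (h + 0))
    (phi m - phi 0).
  by apply: is_deriveB; apply/sh; rewrite add0r; apply: dPhi; lra.
apply: near_eq_is_derive d; near=> h.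
have h1 : `|h| < 1.
  by near: h; exists 1 => //= y; rewrite /ball_ /ball /= sub0r normrN.
rewrite [h + m]addrC [h + 0]addrC.
apply/esym; apply: (@Rintegral_antiderivative _ (fun s => Phi (s + h))) => //.
- move=> s; apply: (cvg_comp (fun s : R => s + h) phi); last exact: cphi.
  by apply: cvgD; [exact: cvg_id|exact: cvg_cst].
- by move=> s s0m; apply/sh; apply: dPhi; move: h1; rewrite ltr_norml; lra.
Unshelve. all: by end_near. Qed.

End SegmentIntegralsOnTheLine.

(** * Segment integrals in the plane *)

Section SegmentIntegrals.
Context {R : realType}.
Notation V := 'rV[R]_2.
Notation mu := (@lebesgue_measure R).
Implicit Types (k f : V -> R) (a v w q : V) (m : R).

Lemma continuous_along k q w : continuous k ->
  continuous (fun s : R => k (q + s *: w)).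
Proof.
move=> ck s; apply: (cvg_comp (fun s : R => q + s *: w) k); last exact: ck.
by apply: cvgD; [exact: cvg_cst|apply: cvgZ; [exact: cvg_id|exact: cvg_cst]].
Qed.

(** Compactness of [[0, m]] makes the continuity of [k] uniform along the
    segment; this replaces any domination hypothesis in the two passages to the
    limit under the integral below. *)
Lemma continuous_near_segment k a m q (e : R) : continuous k -> 0 < e ->
  \forall q' \near q, forall s, 0 <= s <= m ->
    `|k (q' + s *: a) - k (q + s *: a)| <= e.
Proof.
move=> ck e0.
have /compact_near_coveringP cover := @segment_compact R 0 m.
have := cover V (nbhs q)
  (fun q' s => `|k (q' + s *: a) - k (q + s *: a)| <= e) _ _.
have gap0 (s : R) : k (x.2 + x.1 *: a) - k (q + x.1 *: a) @[x --> (s, q)] --> 0.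
  rewrite -[X in _ --> X](subrr (k (q + s *: a))); apply: cvgB.
    apply: (cvg_comp (fun x : R * V => x.2 + x.1 *: a) k); last exact: ck.
    apply: cvgD; first exact: cvg_snd.
    by apply: cvgZ; [exact: cvg_fst|exact: cvg_cst].
  apply: (cvg_comp (fun x : R * V => q + x.1 *: a) k); last exact: ck.
  apply: cvgD; first exact: cvg_cst.
  by apply: cvgZ; [exact: cvg_fst|exact: cvg_cst].
move=> near_all; have {}near_all : \forall q' \near q,
    `[0, m]%classic `<=` (fun s => `|k (q' + s *: a) - k (q + s *: a)| <= e).
  apply: near_all => s _; have /cvgr0Pnorm_le/(_ e e0) := gap0 s. exact.
apply: filterS near_all => q' close s s0m; apply: close.
by rewrite /= in_itv.
Qed.

Lemma segment_integral_continuous k a m : 0 < m -> continuous k ->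
  continuous (segment_integral a m k).
Proof.
move=> m0 ck q; apply/(@cvgrPdist_le _ _ _ (nbhs q)) => e e0.
have em0 : 0 < e / m by rewrite divr_gt0.
have := continuous_near_segment a m q ck em0.
apply: (@filterS _ (nbhs q)) => q' close.
rewrite distrC -(divfK (lt0r_neq0 m0) e).
by apply: Rintegral_dist_le (ltW m0) _ _ close; exact: continuous_along.
Qed.

Lemma is_derive_segment_along k a m q : 0 < m -> continuous k ->
  is_derive q a (segment_integral a m k) (k (q + m *: a) - k q).
Proof.
move=> m0 ck; apply: is_derive_cvg.
have /cvg_is_derive := is_derive_window m0 (@continuous_along _ q a ck).
rewrite scale0r addr0; apply: cvg_trans; apply: near_eq_cvg; near=> h.
congr (_ * (_ - _)); apply: eq_Rintegral => s _ /=.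
  by rewrite add0r [h *: 1]mulr1 -addrA -scalerDl [h + s]addrC.
by rewrite addr0.
Unshelve. all: by end_near. Qed.

(** By the mean value theorem the difference quotient of [k] is a nearby value
    of [k'], hence converges uniformly along the segment. *)
Lemma is_derive_under_segment k k' a v m q : 0 < m ->
  continuous k -> continuous k' -> (forall q, is_derive q v k (k' q)) ->
  is_derive q v (segment_integral a m k) (segment_integral a m k' q).
Proof.
move=> m0 ck ck' kk'; apply: is_derive_cvg; apply/cvgrPdist_le => e e0.
have em0 : 0 < e / m by rewrite divr_gt0.
have := continuous_near_segment a m q ck' em0.
have := @cvg_along _ _ q v.
move=> /[apply] -[d /= d0 close]; exists d => //= h.
rewrite /ball_ /= sub0r normrN => hd h_neq0.
pose psi (s : R) := h^-1 * (k (q + h *: v + s *: a) - k (q + s *: a)).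
have cpsi : continuous psi.
  move=> s; apply: cvgM; first exact: cvg_cst.
  by apply: cvgB; exact: continuous_along.
have -> : h^-1 * (segment_integral a m k (q + h *: v) -
    segment_integral a m k q)
    = \int[mu]_(s in `[0, m]) psi s.
  rewrite RintegralZl //; last first.
    apply: (@continuous_integrable_itv _
      (fun s => k (q + h *: v + s *: a) - k (q + s *: a))).
    by move=> s; apply: cvgB; exact: continuous_along.
  by rewrite RintegralB //; apply: continuous_integrable_itv;
    exact: continuous_along.
rewrite -(divfK (lt0r_neq0 m0) e).
apply: Rintegral_dist_le (ltW m0) _ cpsi _; first exact: continuous_along.
move=> s s0m; rewrite /psi addrAC.
have [r rh ->] := directional_mvt kk' (q + s *: a) h.
rewrite mulKf // addrAC distrC; apply: close => //.
by rewrite /ball_ /= sub0r normrN (le_lt_trans rh).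
Qed.

End SegmentIntegrals.

(** * Ray integrals of compactly supported functions *)

Section Rays.
Context {R : realType}.
Notation V := 'rV[R]_2.
Notation mu := (@lebesgue_measure R).
Implicit Types (f : V -> R) (w q : V).

Lemma Cc_eq0_far f : Cc f -> exists M : R, forall x, M < `|x| -> f x = 0.
Proof.
move=> [_ /compact_bounded[M [_ Mf]]]; exists (M + 1) => x Mx.
apply/eqP; apply: contraTT Mx => fx; rewrite -leNgt.
by apply: (Mf _ _ x); [rewrite ltrDl|exact: subset_closure].
Qed.

(** Near a given point all rays leave the support of [f] before one common time
    [T], so the results on segments transfer to rays; the vanishing of [f] at
    the far end removes one of the two boundary terms of the derivative. *)
Lemma ray_integral_near_segment f w q : Cc f -> w != 0 ->
  exists2 T : R, 0 < T & \forall q' \near q,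
    f (q' + T *: w) = 0 /\ ray_integral w f q' = segment_integral w T f q'.
Proof.
move=> /Cc_eq0_far[M fM] w0.
have w_gt0 : 0 < `|w| by rewrite normr_gt0.
(* For [`|q - q'| < 1] and [t >= T], [`|t *: w| >= `|M| + `|q| + 2] forces
   [`|q' + t *: w| > M]. *)
pose T := (`|M| + `|q| + 2) / `|w|.
have T0 : 0 < T by rewrite divr_gt0 // ltr_wpDl // addr_ge0.
exists T => //.
have : \forall q' \near q, `|q - q'| < 1.
  by have /cvgrPdist_lt/(_ 1 ltr01) : x @[x --> q] --> q by exact: cvg_id.
apply: filterS => q' q'1.
have far t : T <= t -> f (q' + t *: w) = 0.
  move=> Tt; apply: fM.
  have tw : `|M| + `|q| + 2 <= `|t *: w|.
    by rewrite normrZ -ler_pdivrMr // (le_trans Tt) // ler_norm.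
  have := ler_distD q' q 0; rewrite !subr0.
  have := ler_distD q q' 0; rewrite !subr0 [`|q' - q|]distrC.
  have : `|t *: w| <= `|q' + t *: w| + `|q'|.
    by rewrite -{1}(addrK q' (t *: w)) [_ + q']addrC ler_normB.
  have := ler_norm M; lra.
split; first exact: far.
rewrite /ray_integral /segment_integral Rintegral_mkcond [RHS]Rintegral_mkcond.
apply: eq_Rintegral => t _; rewrite /patch !mem_setE !in_itv /= andbT.
have [tT|/ltW Tt] := leP t T; first by rewrite andbT.
by rewrite andbF far // if_same.
Qed.

Lemma ray_integral_continuous f w : Cc f -> w != 0 ->
  continuous (ray_integral w f).
Proof.
move=> fCc w0 q; have [T T0 near_eq] := ray_integral_near_segment q fCc w0.
have cS := @segment_integral_continuous _ f w T T0 fCc.1.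
rewrite /continuous_at; have [_ ->] := nbhs_singleton near_eq.
apply: cvg_trans (cS q); apply: (@near_eq_cvg _ _ (nbhs q)).
by apply: filterS near_eq => q' [].
Qed.

Lemma is_derive_ray_integral f w q : Cc f -> w != 0 ->
  is_derive q w (ray_integral w f) (- f q).
Proof.
move=> fCc w0; have [T T0 near_eq] := ray_integral_near_segment q fCc w0.
have := @is_derive_segment_along _ f w T q T0 fCc.1.
have [-> _] := nbhs_singleton near_eq.
rewrite sub0r; apply: near_eq_is_derive.
by apply: filterS near_eq => q' [].
Qed.

End Rays.

(** * Two derivatives of the integrated V-line transform *)

Section VLine.
Context {R : realType}.
Notation V := 'rV[R]_2.
Implicit Types (f : V -> R) (a u v q : V) (cu cv N m : R).

Lemma segment_integral_comb (k l : V -> R) a m (c d : R) :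
  continuous k -> continuous l ->
  segment_integral a m (fun q => c * k q + d * l q) =
  c \*: segment_integral a m k + d \*: segment_integral a m l.
Proof.
move=> ck cl; apply/funext => q; rewrite /segment_integral.
have ik := continuous_integrable_itv 0 m (@continuous_along _ k q a ck).
have il := continuous_integrable_itv 0 m (@continuous_along _ l q a cl).
rewrite RintegralD //.
- by rewrite !RintegralZl.
- apply: (@continuous_integrable_itv _ (fun s => c * k (q + s *: a))) => s.
  by apply: cvgM; [exact: cvg_cst|exact: continuous_along].
- apply: (@continuous_integrable_itv _ (fun s => d * l (q + s *: a))) => s.
  by apply: cvgM; [exact: cvg_cst|exact: continuous_along].
Qed.

(** The derivative along [v] of the integral of the [u]-rays is computed from
    its derivatives along [a] and [u]; the segment integral of [f] that comes
    from the latter cancels the one that comes from the [v]-rays.  Only ray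
    integrals remain, which explains why a second derivative exists although
    [f] is merely continuous. *)
Lemma is_derive_segment_vline f a u v q cu cv N m : Cc f ->
  u != 0 -> v != 0 -> cu != 0 -> N *: a = cu *: v + cv *: u -> 0 < m ->
  is_derive q v (segment_integral a m (vline_transform u v cu cv f))
    (N * (ray_integral u f (q + m *: a) - ray_integral u f q)).
Proof.
move=> fCc u0 v0 cu0 aE m0.
have cX := ray_integral_continuous fCc u0.
have cXv := ray_integral_continuous fCc v0.
have cf := fCc.1.
have cNf : continuous (fun q => - f q).
  by move=> x; apply: (@cvgN _ _ _ (nbhs x)); exact: cf.
(* [F] is the common derivative of the two ray terms along their own rays. *)
pose F q := segment_integral a m (fun q => - f q) q.
have du x : is_derive x u (segment_integral a m (ray_integral u f)) (F x).
  exact: (@is_derive_under_segment _ (ray_integral u f) _ a u m x m0 cX cNf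
    (fun y => @is_derive_ray_integral _ f u y fCc u0)).
have dv : is_derive q v (segment_integral a m (ray_integral v f)) (F q).
  exact: (@is_derive_under_segment _ (ray_integral v f) _ a v m q m0 cXv cNf
    (fun y => @is_derive_ray_integral _ f v y fCc v0)).
have da x := @is_derive_segment_along _ (ray_integral u f) a m x m0 cX.
have vE : v = (N / cu) *: a + ((- (cv / cu)) *: u + 0).
  rewrite addr0 mulrC -scalerA aE scalerDr !scalerA mulVf // scale1r.
  by rewrite scaleNr [cv / cu]mulrC addrK.
have duv : is_derive q v (segment_integral a m (ray_integral u f))
   (N / cu * (ray_integral u f (q + m *: a) - ray_integral u f q) +
   (- (cv / cu) * F q + 0)).
  rewrite [X in is_derive _ X]vE.
  apply: (@is_derive_comb _ _ _ (fun x => ray_integral u f (x + m *: a) -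
    ray_integral u f x)) => //.
    apply: (@cvgB _ _ _ (nbhs q)); last exact: cX.
    exact: (continuous_translate cX).
  apply: (@is_derive_comb _ _ _ F); last exact: is_derive0.
  exact: (@segment_integral_continuous _ (fun q => - f q) a m m0 cNf).
rewrite (_ : vline_transform _ _ _ _ _ =
  fun q => cv * ray_integral v f q + cu * ray_integral u f q) //.
rewrite segment_integral_comb //.
apply: (is_derive_eq (is_deriveD (is_deriveZ cv dv) (is_deriveZ cu duv))).
by rewrite /GRing.scale /=; field.
Qed.

Lemma is_derive_ray_gap f a u q N m : Cc f -> u != 0 ->
  is_derive q u
    (fun q => N * (ray_integral u f (q + m *: a) - ray_integral u f q))
    (N * (f q - f (q + m *: a))).
Proof.
move=> fCc u0.
have d1 := @is_derive_ray_integral _ f u q fCc u0.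
have d2 : is_derive q u (fun q => ray_integral u f (q + m *: a))
    (- f (q + m *: a)).
  apply: is_derive_cvg.
  have /cvg_is_derive := @is_derive_ray_integral _ f u (q + m *: a) fCc u0.
  by apply: cvg_trans; apply: near_eq_cvg; near=> h;
    rewrite [q + h *: u + _]addrAC.
apply: (is_derive_eq (is_deriveZ N (is_deriveB d2 d1))).
by rewrite /GRing.scale /= opprK addrC.
Unshelve. all: by end_near. Qed.

End VLine.

(** * The normalizing constant *)

Section EuclideanPlane.
Context {R : realType}.
Notation V := 'rV[R]_2.
Implicit Types u v w : V.

Lemma dotE u v : dot u v = u 0 0 * v 0 0 + u 0 1 * v 0 1.
Proof.
by rewrite /dot mxE big_ord_recl big_ord1 !mxE;
  congr (_ + u _ _ * v _ _); apply/val_inj.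
Qed.

Lemma dotvv_ge0 u : 0 <= dot u u.
Proof. by rewrite dotE addr_ge0 // -expr2 sqr_ge0. Qed.

Lemma enorm_sqr u : enorm u ^+ 2 = dot u u.
Proof. by rewrite sqr_sqrtr // dotvv_ge0. Qed.

Lemma enorm_ge0 u : 0 <= enorm u. Proof. exact: sqrtr_ge0. Qed.

Lemma enorm0 : enorm (0 : V) = 0.
Proof. by rewrite /enorm dotE !mxE !mul0r addr0 sqrtr0. Qed.

Lemma unit_neq0 u : enorm u = 1 -> u != 0.
Proof.
by move=> u1; apply: contra_eq_neq u1 => ->; rewrite enorm0 eq_sym oner_neq0.
Qed.

Lemma cos_angle_unit u v : enorm u = 1 -> enorm v = 1 ->
  cos (angle u v) = dot u v.
Proof.
move=> u1 v1; rewrite /angle u1 v1 mulr1 divr1 acosK //.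
have /eqP := enorm_sqr u; have /eqP := enorm_sqr v.
rewrite u1 v1 expr1n !dotE in_itv /= => /eqP E1 /eqP E2; apply/andP; split.
  have := sqr_ge0 (u 0 0 + v 0 0); have := sqr_ge0 (u 0 1 + v 0 1); nra.
have := sqr_ge0 (u 0 0 - v 0 0); have := sqr_ge0 (u 0 1 - v 0 1); nra.
Qed.

(** The vectors [cu *: v], [cv *: u] and their sum form a triangle; for
    [0 < cu] its angles are [beta1], opposite [cv *: u], [beta2], opposite
    [cu *: v], and [pi - 2 * beta].  For [cu < 0] also [beta2] is negative, so
    the proof is algebraic: it compares squares, both sides being
    nonnegative. *)
Lemma law_of_sines u v (cu cv beta beta1 beta2 : R) :
  enorm u = 1 -> enorm v = 1 -> 0 < 2 * beta < pi -> angle u v = 2 * beta ->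
  cu != 0 -> 0 < cv -> 0 < beta1 < pi -> 0 < `|beta2| < pi ->
  beta1 + beta2 = 2 * beta -> sin beta1 / sin beta2 = cv / cu ->
  enorm (cu *: v + cv *: u) * sin beta1 = cv * sin (2 * beta).
Proof.
move=> u1 v1 beta_itv uvE cu0 cv0 beta1_itv beta2_itv sumE ratioE.
have s1 : 0 < sin beta1 by apply: sin_gt0_pi.
have s : 0 < sin (2 * beta) by apply: sin_gt0_pi.
have s2 : sin beta2 != 0.
  have [b2|b2] := leP 0 beta2.
    by rewrite gt_eqF // sin_gt0_pi //;
      move: beta2_itv; rewrite ger0_norm.
  rewrite -oppr_eq0 -sinN gt_eqF // sin_gt0_pi //.
  by move: beta2_itv; rewrite ltr0_norm.
have prodE : cv * sin beta2 = cu * sin beta1.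
  have E : sin beta1 * cu = cv / cu * (sin beta2 * cu).
    by rewrite -ratioE mulrA divfK.
  by rewrite [RHS]mulrC E; field.
apply/eqP; rewrite -(@eqrXn2 _ 2) //; last 2 first.
- by rewrite mulr_ge0 ?enorm_ge0 // ltW.
- by rewrite mulr_ge0 // ltW.
have normE : enorm (cu *: v + cv *: u) ^+ 2 =
    cu ^+ 2 + cv ^+ 2 + 2 * cu * cv * cos (2 * beta).
  rewrite -uvE cos_angle_unit // enorm_sqr !dotE !mxE.
  have := enorm_sqr u; have := enorm_sqr v; rewrite u1 v1 expr1n !dotE.
  move=> E1 E2; transitivity (cu ^+ 2 * (v 0 0 * v 0 0 + v 0 1 * v 0 1) +
    cv ^+ 2 * (u 0 0 * u 0 0 + u 0 1 * u 0 1) +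
    2 * cu * cv * (u 0 0 * v 0 0 + u 0 1 * v 0 1)); first by ring.
  by rewrite -E1 -E2 !mulr1.
rewrite exprMn normE -sumE cosD sinD.
(* Modulo [prodE] and the two Pythagorean identities, the law of cosines
   times [sin beta1 ^+ 2] is the square of the right-hand side. *)
have -> : (cu ^+ 2 + cv ^+ 2 + 2 * cu * cv *
      (cos beta1 * cos beta2 - sin beta1 * sin beta2)) * sin beta1 ^+ 2 =
    (cv * (sin beta1 * cos beta2 + cos beta1 * sin beta2)) ^+ 2 +
    (cu * sin beta1 - cv * sin beta2) * (cu * sin beta1 + cv * sin beta2 +
      2 * cv * sin beta1 * (cos beta1 * cos beta2 - sin beta1 * sin beta2)) +
    cv ^+ 2 * (sin beta2 ^+ 2 * (1 - (cos beta1 ^+ 2 + sin beta1 ^+ 2)) +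
      sin beta1 ^+ 2 * (1 - (cos beta2 ^+ 2 + sin beta2 ^+ 2))) by ring.
by rewrite !cos2Dsin2 prodE !subrr !(mulr0, mul0r, addr0).
Qed.

End EuclideanPlane.

(** * Positivity of the exit time *)

Section ExitTime.
Context {R : realType}.
Notation V := 'rV[R]_2.
Implicit Types (Omega : set V) (a p : V).

(** Openness keeps the boundary away from [p].  Since the infimum of the empty
    set is 0, a boundary point on the ray is needed too: the supremum of the
    times spent in [Omega], finite by boundedness, gives one. *)
Lemma exit_time_gt0 Omega a p : bounded_set Omega -> open Omega ->
  a != 0 -> Omega p -> 0 < exit_time Omega a p.
Proof.
move=> bOmega oOmega a0 Op.
have a_gt0 : 0 < `|a| by rewrite normr_gt0.
have along (x : V) (B : set V) : nbhs x B ->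
    exists2 d : R, 0 < d & forall t, `|t| < d -> B (x + t *: a).
  move=> xB; have [d /= d0 dB] := @cvg_along _ _ x a B xB.
  by exists d => // t td; apply: dB; rewrite /ball_ /= sub0r normrN.
have nbhs_Omega (x : V) : Omega x -> nbhs x Omega.
  by move=> Ox; exact: open_nbhs_nbhs.
pose S : set R := [set s | 0 <= s /\ Omega (p + s *: a)].
have S0 : S 0 by split => //; rewrite scale0r addr0.
have [M [_ bM]] := bOmega.
have ubS : has_ubound S.
  exists ((M + 1 + `|p|) / `|a|) => s [s0 Os].
  rewrite ler_pdivlMr // -[X in X * _]ger0_norm // -normrZ.
  have le_M : `|p + s *: a| <= M + 1 by apply: bM Os; rewrite ltrDl.
  have := ler_normB (p + s *: a) p; rewrite [p + _]addrC addrK.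
  by move=> /le_trans; apply; rewrite lerD2r [_ + p]addrC.
have supS : has_sup S by split => //; exists 0.
have sup_ge0 : 0 <= sup S by exact: ub_le_sup.
have bdry : boundary Omega (p + sup S *: a).
  split.
    move=> B /along[d d0 dB]; have [s Ss sup_lt] := sup_adherent d0 supS.
    exists (p + s *: a); split; first exact: Ss.2.
    have -> : p + s *: a = p + sup S *: a + (s - sup S) *: a.
      by rewrite -addrA -scalerDl subrKC.
    apply: dB; rewrite ler0_norm ?subr_le0.
      by rewrite opprB ltrBlDr -ltrBlDl.
    exact: ub_le_sup.
  move=> /interior_subset/nbhs_Omega/along[d d0 dO].
  have : S (sup S + d / 2).
    split; first by rewrite addr_ge0 // divr_ge0 // ltW.
    rewrite scalerDl addrA; apply: dO.
    by rewrite gtr0_norm ?divr_gt0 // ltr_pdivrMr // mulr_natr mulr2n ltrDl.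
  by move=> /(ub_le_sup ubS); rewrite gerDl leNgt divr_gt0.
have [d d0 dO] := along p Omega (nbhs_Omega p Op).
apply: (lt_le_trans d0); apply: lb_le_inf; first by exists (sup S).
move=> s [s0 [_ ns]]; rewrite leNgt; apply/negP => sd; apply: ns.
by apply: nbhs_Omega; apply: dO; rewrite ger0_norm.
Qed.

End ExitTime.

(** * The inversion formula *)

Theorem theorem9 (R : realType) (u v : 'rV[R]_2) (cu cv beta beta1 beta2 : R)
    (Omega : set 'rV[R]_2) (f : 'rV[R]_2 -> R) (p : 'rV[R]_2)
    (u_unit : enorm u = 1) (v_unit : enorm v = 1)
    (uv_free : free [:: u; v])
    (beta_itv : 0 < 2 * beta < pi) (uv_angle : angle u v = 2 * beta)
    (cu_neq0 : cu != 0) (cv_gt0 : 0 < cv)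
    (beta1_itv : 0 < beta1 < pi) (beta2_itv : 0 < `|beta2| < pi)
    (beta12_sum : beta1 + beta2 = 2 * beta)
    (beta12_ratio : sin beta1 / sin beta2 = cv / cu)
    (Omega_bounded : bounded_set Omega) (Omega_open : open Omega)
    (Omega_convex : convex_set Omega)
    (f_Cc : Cc f) (p_Omega : Omega p) :
  let g := vline_transform u v cu cv f in
  let a := weighted_axis u v cu cv in
  let mp := exit_time Omega a p in
  let m := fun n : nat => mp - n%:R^-1 in
  let G := fun n : nat => segment_integral a (m n) g in
  let L := fun n : nat =>
    sin beta1 / (cv * sin (2 * beta)) * 'D_u (fun q => 'D_v (G n) q) p in
  [/\ (fun n => p + m n *: a) @ \oo --> p + mp *: a,
      forall n : nat, (0 < n)%N -> 0 < m n ->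
        (\forall q \near p, derivable (G n) q v) /\
        derivable (fun q => 'D_v (G n) q) p u,
      cvgn L
    & f p = f (p + mp *: a) + limn L].
Proof.
move=> g a mp m G L.
have u0 := unit_neq0 u_unit; have v0 := unit_neq0 v_unit.
set w := cu *: v + cv *: u; set N := enorm w.
have sines : N * sin beta1 = cv * sin (2 * beta).
  exact: (@law_of_sines _ _ _ _ _ _ _ beta2).
have s1 : 0 < sin beta1 by apply: sin_gt0_pi.
have N0 : 0 < N.
  by rewrite -(pmulr_lgt0 _ s1) sines mulr_gt0 // sin_gt0_pi.
have aE : N *: a = w by rewrite scalerA divff ?scale1r // gt_eqF.
have w0 : w != 0 by apply: contraTneq N0 => w0; rewrite /N w0 enorm0 ltxx.
have a0 : a != 0 by apply: contraNneq w0 => a0; rewrite -aE a0 scaler0.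
have mp0 : 0 < mp by exact: exit_time_gt0.
have dG n q : 0 < m n -> is_derive q v (G n)
    (N * (ray_integral u f (q + m n *: a) - ray_integral u f q)).
  exact: is_derive_segment_vline.
have dDG n : 0 < m n -> is_derive p u (fun q => 'D_v (G n) q)
    (N * (f p - f (p + m n *: a))).
  move=> mn0; rewrite (_ : (fun q => _) = fun q =>
    N * (ray_integral u f (q + m n *: a) - ray_integral u f q)).
    exact: is_derive_ray_gap.
  by apply/funext => q; have [_ ->] := dG n q mn0.
have m_cvg : m n @[n --> \oo] --> mp.
  rewrite -[X in _ --> X]subr0; apply: cvgB; first exact: cvg_cst.
  by rewrite -cvg_shiftS; exact: cvg_harmonic.
have pm_cvg : p + m n *: a @[n --> \oo] --> p + mp *: a.
  by apply: cvgD; [exact: cvg_cst|apply: cvgZ; [exact: m_cvg|exact: cvg_cst]].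
have L_cvg : L n @[n --> \oo] --> f p - f (p + mp *: a).
  have : f p - f (p + m n *: a) @[n --> \oo] --> f p - f (p + mp *: a).
    apply: cvgB; first exact: cvg_cst.
    exact: (cvg_comp _ _ pm_cvg (f_Cc.1 _)).
  apply: cvg_trans; apply: near_eq_cvg; near=> n.
  have mn0 : 0 < m n by near: n; exact: (cvgr_gt _ m_cvg).
  rewrite /L -sines; have [_ ->] := dDG n mn0.
  by field; rewrite !gt_eqF.
split => //.
- move=> n _ mn0; split; last by case: (dDG n mn0).
  by apply: (@nearW _ (nbhs p)) => q; case: (dG n q mn0).
- by apply: cvgP L_cvg.
- by rewrite (cvg_lim _ L_cvg) // addrC subrK.
Unshelve. all: by end_near. Qed.
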